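(* Let $\Gamma$ be a compact group and let $\rho_n\colon\Gamma\to\mathrm{GL}_d(\mathbb{C}_p)$ be a uniformly trace-convergent sequence of continuous representations. Let $G_n$ denote the Zariski closure of $\rho_n(\Gamma)$ in $\mathrm{GL}_d$. Then $|\pi_0(G_n)|$ is bounded independently of $n$.
   Context: $\mathbb{C}_p$ is the completion of an algebraic closure of $\mathbb{Q}_p$. The sequence is uniformly trace-convergent if the functions $g\mapsto\mathrm{tr}(\rho_n(g))$ converge uniformly on $\Gamma$. $\pi_0(G_n)=G_n/G_n^\circ$ is the component group. *)

(* Defs.v *)
From HB Require Import structures.
From mathcomp Require Import all_boot all_order all_algebra.
From mathcomp Require Import all_classical all_reals all_analysis.
From mathcomp Require Import (canonicals) mpoly.

Set Implicit Arguments.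
Unset Strict Implicit.
Unset Printing Implicit Defensive.

Import Order.TTheory GRing.Theory Num.Theory.

Local Open Scope classical_set_scope.
Local Open Scope ring_scope.

HB.mixin Record Group_Topological_isTopGroup G of Group G & Topological G := {
  mulg_continuous : continuous (fun xy : G * G => (xy.1 * xy.2)%g) ;
  invg_continuous : continuous (fun x : G => (x^-1)%g)
}.

#[short(type="topGroupType")]
HB.structure Definition TopGroup :=
  {G of Group G & Topological G & Group_Topological_isTopGroup G}.

(* Fields with a nonarchimedean absolute value. *)
HB.mixin Record Field_isValued (R : realType) K of GRing.Field K := {
  absv : K -> R ;
  absv_ge0 : forall x, 0 <= absv x ;
  absv_eq0 : forall x, absv x = 0 <-> x = 0 ;
  absvM : forall x y, absv (x * y) = absv x * absv y ;
  absvD_max : forall x y, absv (x + y) <= Num.max (absv x) (absv y)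
}.

#[short(type="valuedFieldType")]
HB.structure Definition ValuedField (R : realType) :=
  {K of GRing.Field K & Field_isValued R K}.

(* The topology of a valued field is that of the metric |x - y|. *)
Section valued_field_metric.
Variables (R : realType) (K : valuedFieldType R).
Implicit Types x y z : K.

Definition absv_dist x y : R := absv (x - y).

Lemma absv1 : absv (1 : K) = 1 :> R.
Proof.
have nz1 : absv (1 : K) != 0 :> R.
  by apply/eqP => /absv_eq0/eqP; rewrite oner_eq0.
by apply: (mulfI nz1); rewrite -absvM !mulr1.
Qed.

Lemma absvN x : absv (- x) = absv x :> R.
Proof.
have N1 : absv (-1 : K) = 1 :> R.
  by apply/eqP; rewrite -sqrp_eq1 ?absv_ge0// expr2 -absvM mulrNN mulr1 absv1.
by rewrite -mulN1r absvM N1 mul1r.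
Qed.

Lemma absv_distxx x : absv_dist x x = 0.
Proof. by rewrite /absv_dist subrr; apply/absv_eq0. Qed.

Lemma absv_dist_positivity x y : absv_dist x y = 0 -> x = y.
Proof. by move/absv_eq0/eqP; rewrite subr_eq0 => /eqP. Qed.

Lemma absv_dist_sym x y : absv_dist x y = absv_dist y x.
Proof. by rewrite /absv_dist -absvN opprB. Qed.

Lemma absv_dist_triangle y x z : absv_dist x z <= absv_dist x y + absv_dist y z.
Proof.
rewrite /absv_dist -[x - z](subrKA y) addrC (le_trans (absvD_max _ _))// addrC.
by rewrite ge_max lerDl lerDr !absv_ge0.
Qed.

HB.instance Definition _ :=
  isMetric.Build R K absv_distxx absv_dist_positivity absv_dist_sym absv_dist_triangle.

End valued_field_metric.

Section padic.
Variable R : realType.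

Definition padic_abs (p : nat) (q : rat) : R :=
  if q == 0 then 0
  else p%:R ^ ((logn p `|denq q|%N)%:Z - (logn p `|numq q|%N)%:Z).

Definition is_complete (T : uniformType) :=
  forall F : set_system T, ProperFilter F -> cauchy F -> exists l : T, F --> l.

Definition is_completion (K : fieldType) (abs : K -> R)
    (L : valuedFieldType R) (f : {rmorphism K -> L}) :=
  [/\ forall x, absv (f x) = abs x, dense (range f) & is_complete L].

Definition is_algebraic_closure (K L : fieldType) (f : {rmorphism K -> L}) :=
  GRing.closed_field_axiom L /\ forall x : L, algebraicOver f x.

(* [C] is the completion of an algebraic closure [Qpbar] of [Qp], where [Qp] is
   the completion of the rationals for the p-adic absolute value and [Qpbar]
   carries the absolute value extending that of [Qp]. This determines [C] up to
   isometric isomorphism. *)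
Definition is_Cp (p : nat) (C : valuedFieldType R) : Prop :=
  exists (Qp Qpbar : valuedFieldType R) (h : {rmorphism rat -> Qp})
         (i : {rmorphism Qp -> Qpbar}) (j : {rmorphism Qpbar -> C}),
  [/\ is_completion (padic_abs p) h,
      is_algebraic_closure i,
      forall x, absv (i x) = absv x :> R &
      is_completion absv j].

End padic.

(* The d x d matrices with the Zariski topology of affine d^2-space, as opposed
   to the product topology that ['M[K]_d] inherits from a topology on K. *)
Definition zariski_mx (K : fieldType) (d : nat) : Type := 'M[K]_d.

HB.instance Definition _ (K : fieldType) (d : nat) :=
  Choice.copy (zariski_mx K d) 'M[K]_d.

Section zariski_topology.
Variables (K : fieldType) (d : nat).
Local Notation mxpoly := (mpoly.mpoly (d * d) K).

Definition poly_eval (A : 'M[K]_d) (P : mxpoly) : K :=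
  mpoly.meval (fun k => mxvec A 0 k) P.

Lemma poly_evalM A P Q : poly_eval A (P * Q) = poly_eval A P * poly_eval A Q.
Proof. exact: mpoly.mevalM. Qed.

Definition zero_locus (I : set mxpoly) : set (zariski_mx K d) :=
  [set A | forall P, I P -> poly_eval A P = 0].

Definition zariski_open : set_system (zariski_mx K d) :=
  [set U | exists I : set mxpoly, U = ~` zero_locus I].

Lemma zariski_openT : zariski_open setT.
Proof.
exists [set 1]; rewrite -[LHS]setC0; congr (~` _).
apply/esym/seteqP; split=> // A /(_ 1 erefl)/eqP.
by rewrite /poly_eval mpoly.meval1 oner_eq0.
Qed.

Lemma zariski_openI : setI_closed zariski_open.
Proof.
move=> _ _ [I ->] [J ->].
exists [set P | exists Q1 Q2, [/\ I Q1, J Q2 & P = Q1 * Q2]].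
rewrite -setCU; congr (~` _); apply/seteqP; split=> A.
  case=> zA _ [Q1 [Q2 [IQ1 JQ2 ->]]]; rewrite poly_evalM.
    by rewrite (zA _ IQ1) mul0r.
  by rewrite (zA _ JQ2) mulr0.
move=> zA; apply: contrapT => /not_orP[/existsNP[Q1 /not_implyP[IQ1 /eqP nz1]]].
move=> /existsNP[Q2 /not_implyP[JQ2 /eqP nz2]].
have /eqP := zA (Q1 * Q2) (ex_intro _ Q1 (ex_intro _ Q2 (And3 IQ1 JQ2 erefl))).
by rewrite poly_evalM mulf_eq0 (negbTE nz1) (negbTE nz2).
Qed.

Lemma zariski_open_bigU (T : Type) (f : T -> set (zariski_mx K d)) :
  (forall t, zariski_open (f t)) -> zariski_open (\bigcup_t f t).
Proof.
move=> /choice[I fE]; exists (\bigcup_t I t).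
under eq_bigcupr do rewrite fE.
rewrite -setC_bigcap; congr (~` _); apply/seteqP; split=> A zA.
  by move=> P [t _ ItP]; exact: zA ItP.
by move=> t _ P ItP; apply: zA; exists t.
Qed.

HB.instance Definition _ := isOpenTopological.Build (zariski_mx K d)
  zariski_openT zariski_openI zariski_open_bigU.

Definition GL : set (zariski_mx K d) := [set A : 'M[K]_d | A \in unitmx].

(* Closure of [S] in the subspace [GL]. *)
Definition zariski_closure_GL (S : set 'M[K]_d) : set 'M[K]_d :=
  GL `&` closure (S : set (zariski_mx K d)).

Definition identity_component (G : set 'M[K]_d) : set 'M[K]_d :=
  connected_component (G : set (zariski_mx K d)) (1%:M : 'M[K]_d).

(* The underlying set of the component group: the left cosets in [G] of its
   identity component. *)
Definition pi0 (G : set 'M[K]_d) : set (set 'M[K]_d) :=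
  [set [set g *m h | h in identity_component G] | g in G].

End zariski_topology.

Section representations.
Variables (R : realType) (K : valuedFieldType R) (d : nat) (Gamma : topGroupType).

(* A homomorphism Gamma -> GL_d(K); invertibility of the values is implied. *)
Definition continuous_representation (rho : Gamma -> 'M[K]_d) :=
  [/\ rho 1%g = 1%:M, forall g h, rho (g * h)%g = rho g *m rho h &
      continuous rho].

Definition uniformly_trace_convergent (rho : nat -> Gamma -> 'M[K]_d) :=
  exists f : Gamma -> K, {uniform, (fun n g => \tr (rho n g)) @ \oo --> f}.

End representations.

(* Main.v *)
(* A continuous function on the compact group [Gamma] is almost periodic: up to
   [eps], its left translates fall into finitely many classes. Apply this to the
   traces; by uniform convergence the classes of one [rho_N] serve for all
   [n >= N]. If [g] and [g'] share a class, then [A = rho_n (g'^-1 g)] satisfies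
   [|tr A^(k+1) - tr A^k| <= eps] for all [k], so the traces of the powers of
   [B = A - 1] are small; by the Newton identities and Cayley-Hamilton the powers
   [B^j] decay geometrically, as fast as prescribed. Hence, for every polynomial
   function [P], the sequence [k |-> P (A^k)] is the restriction of a p-adic
   analytic function, and by Strassmann's theorem it vanishes identically as soon
   as it has infinitely many zeros. So the set of powers of [A] is Zariski
   irreducible, hence connected, and [rho_n g'] and [rho_n g] lie in the same
   component of [G_n]: there are at most as many components as classes. *)
Require Import Defs.
From mathcomp Require Import all_boot all_order all_algebra perm.
From mathcomp Require Import finmap.
From mathcomp Require Import all_classical all_reals all_analysis.
From mathcomp Require Import (canonicals) mpoly.
From mathcomp Require Import ring zify.

Set Implicit Arguments.
Unset Strict Implicit.
Unset Printing Implicit Defensive.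

Import Order.TTheory GRing.Theory Num.Theory.
Import numFieldNormedType.Exports.

Local Open Scope classical_set_scope.
Local Open Scope ring_scope.

Section ultrametric_inequality.
Variables (R : realType) (K : valuedFieldType R).
Implicit Types (x y : K) (c : R).

Lemma absv0 : absv (0 : K) = 0 :> R.
Proof. exact/absv_eq0. Qed.

Lemma absv_gt0 x : x != 0 -> (0 : R) < absv x.
Proof.
by move=> x0; rewrite lt_def absv_ge0 andbT; apply: contra_neq x0 => /absv_eq0.
Qed.

Lemma absvX x n : absv (x ^+ n) = absv x ^+ n :> R.
Proof. by elim: n => [|n IH]; rewrite ?expr0 ?absv1// !exprS absvM IH. Qed.

Lemma absvV x : x != 0 -> absv x^-1 = (absv x)^-1 :> R.
Proof.
move=> x0; have := lt0r_neq0 (absv_gt0 x0) => ax0.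
by apply: (mulfI ax0); rewrite -absvM !divff ?absv1.
Qed.

Lemma absvD_le c x y : absv x <= c -> absv y <= c -> absv (x + y) <= c.
Proof. by move=> xc yc; rewrite (le_trans (absvD_max x y))// ge_max xc. Qed.

Lemma absvB_le c x y : absv x <= c -> absv y <= c -> absv (x - y) <= c.
Proof. by move=> xc yc; rewrite absvD_le ?absvN. Qed.

Lemma absv_sum_le (I : Type) (r : seq I) (P : pred I) (F : I -> K) c :
  0 <= c -> (forall i, P i -> absv (F i) <= c) ->
  absv (\sum_(i <- r | P i) F i) <= c.
Proof.
move=> c0 Fc; apply: (big_ind (fun x => absv x <= c)) => //.
  by rewrite absv0.
by move=> x y; exact: absvD_le.
Qed.

Lemma absvM_le c1 c2 x y :
  absv x <= c1 -> absv y <= c2 -> absv (x * y) <= c1 * c2.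
Proof. by move=> xc yc; rewrite absvM ler_pM ?absv_ge0. Qed.

Lemma absv_natr_le1 n : absv (n%:R : K) <= 1 :> R.
Proof.
by elim: n => [|n IH]; rewrite ?absv0// mulrS absvD_le ?absv1.
Qed.

Lemma ball_absvE x c y : ball x c y = (absv (x - y) < c) :> Prop.
Proof. by rewrite ballEmdist. Qed.

Lemma absv_fact_le m n : (0 < m <= n)%N ->
  absv (n`!%:R : K) <= absv (m%:R : K) :> R.
Proof.
move=> /dvdn_fact/dvdnP[q ->].
by rewrite natrM absvM ler_piMl ?absv_ge0 ?absv_natr_le1.
Qed.

End ultrametric_inequality.

Section finite_differences.
Variable V : zmodType.
Implicit Types (f g : nat -> V) (j k n : nat).

Definition fdiff f : nat -> V := fun k => f k.+1 - f k.

Lemma newton_forward f n k : (k <= n)%N ->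
  f k = \sum_(j < n.+1) iter j fdiff f 0%N *+ 'C(k, j).
Proof.
elim: k f => [|k IH] f kn.
  by rewrite big_ord_recl bin0 mulr1n big1 ?addr0.
have -> : f k.+1 = f k + fdiff f k by rewrite /fdiff addrC subrK.
rewrite (IH f (ltnW kn)) (IH (fdiff f) (ltnW kn)).
rewrite [X in _ + X]big_ord_recr /= (@bin_small k n)// addr0.
rewrite big_ord_recl [RHS]big_ord_recl /= !bin0 !mulr1n -addrA -big_split /=.
congr (_ + _); apply: eq_bigr => j _.
by rewrite /bump /= add1n binS mulrnDr /= -iterSr.
Qed.

Lemma iter_fdiff_cst c j k : iter j.+1 fdiff (fun=> c) k = 0.
Proof.
elim: j k => [|j IH] k; first by rewrite /= /fdiff subrr.
by rewrite iterS {1}/fdiff !IH subrr.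
Qed.

Lemma iter_fdiff_shift f j k :
  iter j fdiff (fun i => f i.+1) k = iter j fdiff f k.+1.
Proof. by elim: j k => //= j IH k; rewrite /fdiff !IH. Qed.

Lemma iter_fdiffD f g j k :
  iter j fdiff (fun i => f i + g i) k = iter j fdiff f k + iter j fdiff g k.
Proof. by elim: j k => //= j IH k; rewrite /fdiff !IH addrACA opprD. Qed.

End finite_differences.

Lemma iter_fdiff_morph (U V : zmodType) (h : U -> V) f j k :
  {morph h : x y / x - y} ->
  iter j (@fdiff V) (fun i => h (f i)) k = h (iter j (@fdiff U) f k).
Proof. by move=> hB; elim: j k => //= j IH k; rewrite /fdiff !IH hB. Qed.

Lemma iter_fdiff_exp (A : pzRingType) (x : A) j k :
  iter j (@fdiff A) (GRing.exp x) k = (x - 1) ^+ j * x ^+ k.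
Proof.
elim: j k => [|j IH] k; first by rewrite expr0 mul1r.
by rewrite iterS {1}/fdiff !IH exprS -mulrBr [in RHS]exprSr -mulrA mulrBl mul1r -exprS.
Qed.

Section bounded_differences.
Variables (R : realType) (K : valuedFieldType R).
Implicit Types (f g : nat -> K) (c C : R).

Lemma absv_iter_fdiff_le c f : (forall k, absv (fdiff f k) <= c) ->
  forall j k, absv (iter j.+1 (@fdiff K) f k) <= c.
Proof. by move=> fc; elim=> [|j IH] k; [exact: fc|rewrite iterS absvB_le]. Qed.

Definition diff_bounded (theta C : R) f :=
  forall j k, absv (iter j (@fdiff K) f k) <= C * theta ^+ j.

Variable theta : R.
Hypothesis theta_ge0 : 0 <= theta.

Lemma diff_bounded_ge0 C f : diff_bounded theta C f -> 0 <= C.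
Proof.
by move=> /(_ 0%N 0%N); rewrite expr0 mulr1; apply: le_trans; rewrite absv_ge0.
Qed.

Lemma diff_bounded_at0 C f : theta <= 1 -> 0 <= C ->
  (forall j, absv (iter j (@fdiff K) f 0%N) <= C * theta ^+ j) ->
  diff_bounded theta C f.
Proof.
move=> theta1 C0 fC j k; elim: k j => [//|k IH] j.
have -> : iter j (@fdiff K) f k.+1 =
    iter j (@fdiff K) f k + iter j.+1 (@fdiff K) f k.
  by rewrite iterS /fdiff addrC subrK.
rewrite absvD_le// (le_trans (IH _))// ler_wpM2l// exprS.
by rewrite ler_piMl ?exprn_ge0.
Qed.

Lemma diff_bounded_le C C' f : C <= C' -> diff_bounded theta C f ->
  diff_bounded theta C' f.
Proof.
by move=> CC fC j k; rewrite (le_trans (fC _ _))// ler_wpM2r// exprn_ge0.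
Qed.

Lemma diff_bounded_cst (x : K) : diff_bounded theta (absv x) (fun=> x).
Proof.
case=> [|j] k; first by rewrite expr0 mulr1.
by rewrite iter_fdiff_cst absv0 mulr_ge0 ?absv_ge0 ?exprn_ge0.
Qed.

Lemma diff_boundedD C f g : diff_bounded theta C f -> diff_bounded theta C g ->
  diff_bounded theta C (fun k => f k + g k).
Proof. by move=> fC gC j k; rewrite iter_fdiffD absvD_le. Qed.

Lemma diff_bounded_shift C f : diff_bounded theta C f ->
  diff_bounded theta C (fun k => f k.+1).
Proof. by move=> fC j k; rewrite iter_fdiff_shift. Qed.

Lemma diff_bounded_fdiff C f : diff_bounded theta C f ->
  diff_bounded theta (C * theta) (fdiff f).
Proof. by move=> fC j k; rewrite -iterSr -mulrA -exprS. Qed.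

Lemma fdiffM f g :
  fdiff (fun k => f k * g k) = (fun k => fdiff f k * g k.+1 + f k * fdiff g k).
Proof. by apply/funext => k; rewrite /fdiff; ring. Qed.

Lemma diff_boundedM C C' f g : diff_bounded theta C f -> diff_bounded theta C' g ->
  diff_bounded theta (C * C') (fun k => f k * g k).
Proof.
move=> fC gC j; elim: j C C' f g fC gC => [|j IH] C C' f g fC gC k.
  rewrite expr0 mulr1 absvM_le//; first by have := fC 0%N k; rewrite mulr1.
  by have := gC 0%N k; rewrite mulr1.
rewrite iterSr fdiffM iter_fdiffD absvD_le//.
  have -> : C * C' * theta ^+ j.+1 = C * theta * C' * theta ^+ j.
    by rewrite exprS; ring.
  exact: IH (diff_bounded_fdiff fC) (diff_bounded_shift gC) k.
have -> : C * C' * theta ^+ j.+1 = C * (C' * theta) * theta ^+ j.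
  by rewrite exprS; ring.
exact: IH fC (diff_bounded_fdiff gC) k.
Qed.

End bounded_differences.

Section coefficient_bounds.
Variables (R : realType) (K : valuedFieldType R) (rho : R).
Hypotheses (rho_ge0 : 0 <= rho) (rho_le1 : rho <= 1).
Implicit Types (P Q : {poly K}) (C : R).

Definition coef_bounded C P := forall i, absv P`_i <= C * rho ^+ i.

Lemma coef_boundedM C C' P Q : 0 <= C -> 0 <= C' ->
  coef_bounded C P -> coef_bounded C' Q -> coef_bounded (C * C') (P * Q).
Proof.
move=> C0 C'0 PC QC i; rewrite coefM absv_sum_le// => [|j _].
  by rewrite !mulr_ge0 ?exprn_ge0.
by rewrite -[X in rho ^+ X](subnKC (leq_ord j)) exprD mulrACA absvM_le.
Qed.

Lemma coef_bounded_divXsubC C Q (z : K) : 0 <= C -> absv z <= 1 ->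
  coef_bounded C (Q * ('X - z%:P)) -> coef_bounded (C * rho) Q.
Proof.
move=> C0 z1 QzC i.
have [n] := ubnP (size Q - i)%N; elim: n i => // n IH i Qn.
have [Qi|iQ] := leqP (size Q) i.
  by rewrite nth_default// absv0 !mulr_ge0 ?exprn_ge0.
have -> : Q`_i = (Q * ('X - z%:P))`_i.+1 + z * Q`_i.+1.
  by rewrite mulrBr coefB coefMX coefMC /=; ring.
rewrite -mulrA -exprS absvD_le//.
rewrite -[leRHS]mul1r absvM_le//.
apply: (le_trans (IH i.+1 _)); first by lia.
by rewrite -mulrA -exprS ler_wpM2l// ler_wiXn2l.
Qed.

Lemma absv_horner_le C P x : 0 <= C -> absv x <= 1 ->
  coef_bounded C P -> absv P.[x] <= C.
Proof.
move=> C0 x1 PC; rewrite horner_coef absv_sum_le// => i _.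
rewrite -[C]mulr1 absvM_le//.
  by rewrite (le_trans (PC _))// ler_piMr// exprn_ile1.
by rewrite absvX exprn_ile1 ?absv_ge0.
Qed.

(* Dividing out a root gains a factor [rho] in the coefficient bound. *)
Lemma absv_horner_le_roots C P (zs : seq K) x : 0 <= C -> absv x <= 1 ->
  uniq zs -> all (root P) zs -> {in zs, forall z, absv z <= (1 : R)} ->
  coef_bounded C P -> absv P.[x] <= C * rho ^+ size zs.
Proof.
move=> C0 x1; elim: zs C C0 P => [|z zs IH] C C0 P.
  by move=> _ _ _; rewrite expr0 mulr1; exact: absv_horner_le.
move=> /= /andP[zzs uzs] /andP[/factor_theorem[Q ->] rzs] zs1 PC.
have z1 : absv z <= (1 : R) by rewrite zs1 ?mem_head.
rewrite hornerM !hornerE /= exprS mulrA -[leRHS]mulr1 absvM_le ?absvB_le//.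
apply: IH => //; first exact: mulr_ge0.
- apply/allP => y yzs; have := allP rzs _ yzs.
  rewrite rootM root_XsubC => /orP[//|/eqP yz].
  by rewrite -yz yzs in zzs.
- by move=> y yzs; apply: zs1; rewrite inE yzs orbT.
- exact: coef_bounded_divXsubC PC.
Qed.

End coefficient_bounds.

Lemma natr_inj (A : idomainType) : [pchar A] =i pred0 ->
  injective (fun n => n%:R : A).
Proof.
move=> /pcharf0P char0 m n; wlog mn : m n / (m <= n)%N => [wlog_le|] mnE.
  by case: (leqP m n) => [|/ltnW] le_mn; [|symmetry]; exact: wlog_le.
by apply/eqP; rewrite eqn_leq mn -subn_eq0 -char0 natrB// mnE subrr /=.
Qed.

Lemma natr_fact_neq0 (A : idomainType) n : [pchar A] =i pred0 -> n`!%:R != 0 :> A.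
Proof. by move=> /pcharf0P ->; rewrite -lt0n fact_gt0. Qed.

Section newton_interpolation.
Variable K : fieldType.
Implicit Types f : nat -> K.

Definition ffact_poly j : {poly K} := \prod_(i < j) ('X - i%:R%:P).

Lemma horner_ffact_poly j k : (ffact_poly j).[k%:R] = (k ^_ j)%:R.
Proof.
elim: j => [|j IH]; first by rewrite /ffact_poly big_ord0 hornerE ffactn0.
rewrite /ffact_poly big_ord_recr hornerM -/(ffact_poly j) IH !hornerE/= ffactnSr.
rewrite natrM; have [jk|kj] := leqP j k; first by rewrite natrB.
by rewrite ffact_small// !mul0r.
Qed.

Lemma size_ffact_poly j : size (ffact_poly j) = j.+1.
Proof. by rewrite size_prod_XsubC -[index_enum _]enumT size_enum_ord. Qed.

Definition newton_poly f n : {poly K} :=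
  \sum_(j < n.+1) (iter j (@fdiff K) f 0%N / j`!%:R) *: ffact_poly j.

Lemma horner_newton_poly f n k : [pchar K] =i pred0 -> (k <= n)%N ->
  (newton_poly f n).[k%:R] = f k.
Proof.
move=> char0 kn; rewrite [RHS](newton_forward f kn) horner_sum.
apply: eq_bigr => j _; rewrite hornerZ horner_ffact_poly -bin_ffact mulnC natrM.
by rewrite -[RHS]mulr_natr mulrA divfK ?natr_fact_neq0.
Qed.

End newton_interpolation.

Definition fact_absv_ge (R : realType) (K : valuedFieldType R) (sigma : R) :=
  forall j, sigma ^+ j <= absv (j`!%:R : K).

(* Strassmann's theorem for a sequence [f] with small differences: on [[0, n]]
   it agrees with its Newton polynomial, out of which the zeros can be divided,
   so that infinitely many zeros force [f = 0]. The factor [sigma ^+ j] in the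
   bound on the differences pays for the denominators [j!] of that polynomial. *)
Section isolated_zeros.
Variables (R : realType) (K : valuedFieldType R) (sigma rho : R).
Hypotheses (sigma_gt0 : 0 < sigma) (rho_ge0 : 0 <= rho) (rho_lt1 : rho < 1).
Hypothesis sigma_fact : fact_absv_ge K sigma.
Implicit Types f : nat -> K.

Lemma fact_absv_ge_pchar0 : [pchar K] =i pred0.
Proof.
apply/pcharf0P => -[|n]; first by rewrite !eqxx.
apply/negbTE/eqP => n0; have := sigma_fact n.+1.
by rewrite factS natrM n0 mul0r absv0 leNgt exprn_gt0.
Qed.

Lemma ffact_poly_coef_bounded j : coef_bounded (1 : R) (1 : R) (ffact_poly K j).
Proof.
rewrite /ffact_poly.
apply: (big_ind (coef_bounded (1 : R) (1 : R))) => [i|P Q Pb Qb|k _ i].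
- by rewrite coef1 expr1n mulr1 absv_natr_le1.
- by rewrite -[X in coef_bounded _ X](mulr1 1); exact: coef_boundedM.
rewrite coefB coefX coefC expr1n mulr1 absvB_le ?absv_natr_le1//.
by case: ifP => _; rewrite ?absv_natr_le1// absv0.
Qed.

Lemma newton_poly_coef_bounded f n C : diff_bounded (sigma * rho) C f ->
  coef_bounded rho C (newton_poly f n).
Proof.
move=> fC i; have C0 := diff_bounded_ge0 fC.
rewrite coef_sum absv_sum_le// => [|j _]; first by rewrite mulr_ge0 ?exprn_ge0.
rewrite coefZ; have [ij|ji] := leqP i j; last first.
  by rewrite nth_default ?size_ffact_poly// mulr0 absv0 mulr_ge0 ?exprn_ge0.
have fact0 := natr_fact_neq0 j fact_absv_ge_pchar0.
rewrite -[leRHS]mulr1; apply: absvM_le; last first.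
  by have := ffact_poly_coef_bounded j i; rewrite expr1n mulr1.
rewrite absvM absvV// ler_pdivrMr ?absv_gt0// (le_trans (fC j 0%N))//.
rewrite -mulrA ler_wpM2l// exprMn mulrC ler_pM ?exprn_ge0 ?(ltW sigma_gt0)//.
by rewrite ler_wiXn2l// ltW.
Qed.

Lemma diff_bounded_zeros_le f C (ks : seq nat) k : diff_bounded (sigma * rho) C f ->
  uniq ks -> {in ks, forall i, f i = 0} -> absv (f k) <= C * rho ^+ size ks.
Proof.
move=> fC uks ks0; pose n := (k + \max_(i <- ks) i)%N.
have newtonE i : (i <= n)%N -> (newton_poly f n).[i%:R] = f i.
  exact: (horner_newton_poly f fact_absv_ge_pchar0).
rewrite -(newtonE k) ?leq_addr// -(size_map (fun i => i%:R : K) ks).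
apply: absv_horner_le_roots => //.
- exact: ltW.
- exact: diff_bounded_ge0 fC.
- exact: absv_natr_le1.
- by rewrite map_inj_uniq//; exact/natr_inj/fact_absv_ge_pchar0.
- apply/allP => _ /mapP[i iks ->]; rewrite /root newtonE ?ks0//.
  by rewrite (leq_trans (@leq_bigmax_seq _ _ xpredT id i iks isT))// leq_addl.
- by move=> _ /mapP[i _ ->]; exact: absv_natr_le1.
- exact: newton_poly_coef_bounded.
Qed.

Lemma infinite_zeros_eq0 f C : diff_bounded (sigma * rho) C f ->
  infinite_set [set k | f k = 0] -> forall k, f k = 0.
Proof.
move=> fC /infinite_set_fsetP zeros k; apply/absv_eq0/eqP.
rewrite eq_le absv_ge0 andbT.
have rho_norm : `|rho| < 1 by rewrite ger0_norm.
have lim0 := cvg_geometric C rho_norm.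
rewrite -(cvg_lim _ lim0)//; apply: limr_ge; first by apply/cvg_ex; exists 0.
apply: nearW => m; have [B B0 mB] := zeros m.
apply: le_trans (diff_bounded_zeros_le k fC (fset_uniq B) _) _.
  by move=> i iB; exact: B0.
rewrite ler_wpM2l ?(diff_bounded_ge0 fC)// ler_wiXn2l//; exact: ltW.
Qed.

End isolated_zeros.

Section jacobi_formula.
Variable K : comNzRingType.

Lemma deriv_prod (I : eqType) (r : seq I) (F : I -> {poly K}) : uniq r ->
  (\prod_(i <- r) F i)^`() = \sum_(i <- r) (F i)^`() * \prod_(j <- r | i != j) F j.
Proof.
elim: r => [|i r IH] /=; first by rewrite !big_nil derivC.
case/andP=> ir ur; rewrite !big_cons derivM IH// eqxx /=.
congr (_ * _ + _).
  rewrite big_seq_cond [RHS]big_seq_cond; apply: eq_bigl => j.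
  by rewrite andbT; case: eqVneq => [<-|]; rewrite ?(negbTE ir) ?andbT.
rewrite big_distrr /= [LHS]big_seq [RHS]big_seq; apply: eq_bigr => k kr.
rewrite big_cons; case: eqVneq => [ki|_]; first by rewrite -ki kr in ir.
by rewrite mulrCA.
Qed.

Lemma deriv_det n (M : 'M[{poly K}]_n) :
  (\det M)^`() = \sum_i \sum_j (M i j)^`() * cofactor M i j.
Proof.
rewrite /determinant raddf_sum /=.
transitivity (\sum_(s : 'S_n) \sum_i
    (M i (s i))^`() * ((-1) ^+ s * \prod_(k | i != k) M k (s k))).
  apply: eq_bigr => s _; rewrite mulr_sign (fun_if (@deriv K)) derivN -mulr_sign.
  rewrite deriv_prod ?index_enum_uniq// big_distrr /=.
  by apply: eq_bigr => i _; rewrite mulrCA.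
rewrite exchange_big /=; apply: eq_bigr => i _.
rewrite (partition_big (fun s : 'S_n => s i) xpredT)//=; apply: eq_bigr => j _.
by rewrite expand_cofactor big_distrr; apply: eq_bigr => s /eqP ->.
Qed.

End jacobi_formula.

Section newton_identities.
Variables (K : comNzRingType) (d : nat).
Implicit Types B : 'M[K]_d.

Lemma deriv_char_poly B : (char_poly B)^`() = \tr (\adj (char_poly_mx B)).
Proof.
rewrite deriv_det; apply: eq_bigr => i _; rewrite mxE (bigD1 i)//= big1.
  by rewrite !mxE eqxx derivB derivX derivC subr0 mul1r addr0.
by move=> j ji; rewrite !mxE eq_sym (negbTE ji) sub0r derivN derivC oppr0 mul0r.
Qed.

Definition adj_char_coef B k : 'M[K]_d :=
  map_mx (coefp k) (\adj (char_poly_mx B)).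

(* Coefficients of the identity [('X - B) * adj ('X - B) = char_poly B]. *)
Lemma coef_char_poly_adj B k :
  ((char_poly B)`_k)%:M =
  (if k is k'.+1 then adj_char_coef B k' else 0) - B *m adj_char_coef B k.
Proof.
have /matrixP adjE : 'X *: \adj (char_poly_mx B) -
    map_mx polyC B *m \adj (char_poly_mx B) = (char_poly B)%:M.
  by rewrite -mul_scalar_mx -mulmxBl mul_mx_adj.
apply/matrixP => a b; have /(congr1 (coefp k)) /= := adjE a b.
rewrite !mxE coefMn => <-; rewrite coefB coefXM coef_sum.
congr (_ - _); first by case: k => [|k]; rewrite !mxE.
by apply: eq_bigr => c _; rewrite !mxE coefCM.
Qed.

Lemma adj_char_coef_eventually0 B :
  exists n, forall k, (n <= k)%N -> adj_char_coef B k = 0.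
Proof.
pose deg a b := size (\adj (char_poly_mx B) a b).
exists (\max_a \max_b deg a b) => k nk; apply/matrixP => a b.
rewrite [LHS]mxE [RHS]mxE /= nth_default//; apply: leq_trans nk.
apply: leq_trans (leq_bigmax (F := fun a => \max_b deg a b) a).
exact: leq_bigmax.
Qed.

Lemma adj_char_coefE B k :
  adj_char_coef B k = \sum_(i < d.+1) (char_poly B)`_(k + i).+1 *: B ^+ i.
Proof.
have [m adj0] := adj_char_coef_eventually0 B.
have [n] := ubnP ((m + d) - k)%N; elim: n k => // n IH k kn.
have [mk|km] := leqP (m + d) k.
  rewrite adj0 ?(leq_trans (leq_addr _ _) mk)// big1// => i _.
  rewrite nth_default ?scale0r// size_char_poly ltnS.
  by rewrite (leq_trans (leq_addl _ _) (leq_trans mk (leq_addr _ _))).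
have /= /esym/eqP := coef_char_poly_adj B k.+1.
rewrite subr_eq => /eqP ->; rewrite IH; last by lia.
rewrite [RHS]big_ord_recl addn0 expr0 -scalemx1; congr (_ + _).
rewrite mulmx_sumr big_ord_recr /= [X in X *: _]nth_default; last first.
  by rewrite size_char_poly !ltnS addSn ltnW// ltnS leq_addl.
rewrite scale0r mulmx0 addr0; apply: eq_bigr => i _.
by rewrite -scalemxAr /bump /= add1n addSn addnS exprS.
Qed.

(* The library's [Cayley_Hamilton] excludes [d = 0]. *)
Lemma Cayley_Hamilton_sum B : \sum_(i < d.+1) (char_poly B)`_i *: B ^+ i = 0.
Proof.
have /= char0E := coef_char_poly_adj B 0%N.
rewrite big_ord_recl expr0 scalemx1 char0E adj_char_coefE sub0r big_ord_recr /=.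
rewrite [X in X *: _]nth_default ?size_char_poly// scale0r addr0 mulmx_sumr.
rewrite addrC; apply/eqP; rewrite subr_eq0; apply/eqP; apply: eq_bigr => i _.
by rewrite -scalemxAr /bump /= add1n add0n exprS.
Qed.

Lemma coef_char_poly_lead B : (char_poly B)`_d = 1.
Proof.
by have /monicP := char_poly_monic B; rewrite /lead_coef size_char_poly.
Qed.

Lemma exprmx_char_poly B j : (d <= j)%N ->
  B ^+ j = - \sum_(i < d) (char_poly B)`_i *: B ^+ (j - d + i).
Proof.
move=> dj; have /eqP := Cayley_Hamilton_sum B.
rewrite big_ord_recr /= coef_char_poly_lead scale1r addrC addr_eq0 => /eqP BdE.
rewrite -[in LHS](subnK dj) exprD BdE mulrN; congr (- _).
rewrite big_distrr; apply: eq_bigr => i _.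
by rewrite exprD; exact/esym/scalemxAr.
Qed.

Lemma newton_identity B j : (j <= d)%N ->
  (d - j)%:R * (char_poly B)`_j =
  - \sum_(i < d.+1) (char_poly B)`_(j + i).+1 * \tr (B ^+ i.+1).
Proof.
have trB k : \tr (B *m adj_char_coef B k) =
    \sum_(i < d.+1) (char_poly B)`_(k + i).+1 * \tr (B ^+ i.+1).
  rewrite adj_char_coefE mulmx_sumr raddf_sum /=; apply: eq_bigr => i _.
  by rewrite -scalemxAr mxtraceZ exprS.
have tr_adj k : \tr (adj_char_coef B k) = (char_poly B)`_k.+1 *+ k.+1.
  rewrite -coef_deriv deriv_char_poly coef_sum.
  by apply: eq_bigr => i _; rewrite mxE.
move=> jd; rewrite -trB natrB// mulrBl.
have /(congr1 mxtrace) := coef_char_poly_adj B j.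
rewrite mxtrace_scalar raddfB /= !mulr_natl => ->.
case: j {jd} => [|j]; first by rewrite mulr0n mxtrace0 subr0 sub0r.
by rewrite tr_adj addrAC subrr sub0r.
Qed.

End newton_identities.

(* In characteristic 0 and for [c = 0], this says that [A] is unipotent. *)
Definition near_unipotent (R : realType) (K : valuedFieldType R) (d : nat) (c : R)
    (A : 'M[K]_d) :=
  forall k, absv (\tr (A ^+ k.+1) - \tr (A ^+ k)) <= c.

(* The factor [d!] pays for the divisions in the Newton identities. *)
Definition trace_tolerance (R : realType) (K : valuedFieldType R) (d : nat)
    (theta : R) : R :=
  theta ^+ d * absv (d`!%:R : K).

Section near_unipotent_matrices.
Variables (R : realType) (K : valuedFieldType R) (d : nat).
Implicit Types (c theta : R) (A B : 'M[K]_d).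

Lemma coef_char_poly_le c B : d`!%:R != 0 :> K -> 0 <= c -> c <= 1 ->
  (forall i, absv (\tr (B ^+ i.+1)) <= c * absv (d`!%:R : K)) ->
  forall j, (j < d)%N -> absv (char_poly B)`_j <= c.
Proof.
move=> fact0 c0 c1 trB j.
have [n] := ubnP (d - j)%N; elim: n j => // n IH j dn jd.
have coef1 l : (j < l)%N -> absv (char_poly B)`_l <= (1 : R).
  move=> jl; case: (ltngtP l d) => [ld|dl|->].
  - by rewrite (le_trans (IH l _ ld))//; lia.
  - by rewrite nth_default ?size_char_poly// absv0.
  - by rewrite coef_char_poly_lead absv1.
have dj_le : absv (d`!%:R : K) <= absv ((d - j)%:R : K) :> R.
  by rewrite absv_fact_le// subn_gt0 jd leq_subr.
have dj_gt0 : 0 < absv ((d - j)%:R : K) :> R.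
  exact: lt_le_trans (absv_gt0 fact0) dj_le.
rewrite -(ler_pM2r dj_gt0) mulrC -absvM newton_identity ?(ltnW jd)// absvN.
rewrite absv_sum_le ?mulr_ge0 ?absv_ge0// => i _; rewrite -[leRHS]mul1r absvM_le//.
  by rewrite coef1// ltnS leq_addr.
by rewrite (le_trans (trB i))// ler_wpM2l.
Qed.

Lemma exprmx_coef_le theta B : 0 < theta -> theta <= 1 ->
  (forall j, (j < d)%N -> absv (char_poly B)`_j <= theta ^+ d) ->
  exists2 C : R, 0 <= C & forall j a b, absv ((B ^+ j) a b) <= C * theta ^+ j.
Proof.
move=> theta_gt0 theta_le1 coefB; have theta_ge0 := ltW theta_gt0.
pose F (iab : 'I_d * 'I_d * 'I_d) : R :=
  absv ((B ^+ iab.1.1) iab.1.2 iab.2) / theta ^+ iab.1.1.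
have F0 iab : 0 <= F iab by rewrite divr_ge0 ?absv_ge0 ?exprn_ge0.
pose C := \sum_iab F iab; have C0 : 0 <= C by exact: sumr_ge0.
exists C => // j; have [n] := ubnP j; elim: n j => // n IH j jn a b.
have [jd|dj] := ltnP j d.
  rewrite -ler_pdivrMr ?exprn_gt0// /C (bigD1 (Ordinal jd, a, b))//= lerDl.
  exact: sumr_ge0.
rewrite exprmx_char_poly// mxE summxE absvN.
rewrite absv_sum_le ?mulr_ge0 ?exprn_ge0// => i _.
rewrite mxE -[X in C * theta ^+ X](subnKC dj) [theta ^+ _]exprD mulrCA.
apply: absvM_le; first exact: coefB.
apply: (le_trans (IH _ _ _ _)); first by have := ltn_ord i; lia.
by rewrite ler_wpM2l// ler_wiXn2l// leq_addr.
Qed.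

Lemma absv_trace_subr1_exp_le c A :
  near_unipotent c A -> forall i, absv (\tr ((A - 1) ^+ i.+1)) <= c.
Proof.
move=> trA i; have /(_ i 0%N) := absv_iter_fdiff_le trA.
by rewrite (iter_fdiff_morph _ _ _ (raddfB _)) iter_fdiff_exp expr0 mulr1.
Qed.

Lemma exp_coef_diff_bounded theta A : d`!%:R != 0 :> K -> 0 < theta -> theta <= 1 ->
  near_unipotent (trace_tolerance K d theta) A ->
  exists C, forall a b, diff_bounded theta C (fun k => (A ^+ k) a b).
Proof.
move=> fact0 theta_gt0 theta_le1 /absv_trace_subr1_exp_le trB.
have theta_ge0 := ltW theta_gt0.
have coefB : forall j, (j < d)%N -> absv (char_poly (A - 1))`_j <= theta ^+ d.
  by apply: coef_char_poly_le trB; rewrite ?exprn_ge0 ?exprn_ile1.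
have [C C0 BC] := exprmx_coef_le theta_gt0 theta_le1 coefB.
exists C => a b; apply: diff_bounded_at0 => // j.
rewrite (iter_fdiff_morph (h := fun M : 'M[K]_d => M a b)) => [|M N].
  by rewrite iter_fdiff_exp expr0 mulr1; exact: BC.
by rewrite !mxE.
Qed.

End near_unipotent_matrices.

Section polynomial_functions.
Variable K : fieldType.

Inductive polyfun (d : nat) : ('M[K]_d -> K) -> Prop :=
| polyfun_cst c : polyfun (fun=> c)
| polyfun_coord a b : polyfun (fun A => A a b)
| polyfunD f g : polyfun f -> polyfun g -> polyfun (fun A => f A + g A)
| polyfunM f g : polyfun f -> polyfun g -> polyfun (fun A => f A * g A).

Definition polymap (d m n : nat) (F : 'M[K]_d -> 'M[K]_(m, n)) :=
  forall a b, polyfun (fun A => F A a b).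

Lemma polyfun_big d (op : K -> K -> K) (idx : K) (I : Type) (r : seq I) (P : pred I)
    (F : I -> 'M[K]_d -> K) :
  (forall f g, polyfun f -> polyfun g -> polyfun (fun A : 'M[K]_d => op (f A) (g A))) ->
  (forall i, polyfun (F i)) -> polyfun (fun A => \big[op/idx]_(i <- r | P i) F i A).
Proof.
move=> polyop polyF; elim: r => [|i r IH].
  by under eq_fun do rewrite big_nil; exact: polyfun_cst.
by under eq_fun do rewrite big_cons; case: (P i) => //; exact: polyop.
Qed.

Lemma polyfun_sum d (I : Type) (r : seq I) (P : pred I) (F : I -> 'M[K]_d -> K) :
  (forall i, polyfun (F i)) -> polyfun (fun A => \sum_(i <- r | P i) F i A).
Proof. by apply: polyfun_big; exact: polyfunD. Qed.

Lemma polyfun_prod d (I : Type) (r : seq I) (P : pred I) (F : I -> 'M[K]_d -> K) :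
  (forall i, polyfun (F i)) -> polyfun (fun A => \prod_(i <- r | P i) F i A).
Proof. by apply: polyfun_big; exact: polyfunM. Qed.

Lemma polyfunX d (f : 'M[K]_d -> K) n : polyfun f -> polyfun (fun A => f A ^+ n).
Proof.
move=> polyf; elim: n => [|n IH]; first exact: polyfun_cst.
by under eq_fun do rewrite exprS; exact: polyfunM.
Qed.

Lemma polyfun_comp d n (f : 'M[K]_n -> K) (F : 'M[K]_d -> 'M[K]_n) :
  polyfun f -> polymap F -> polyfun (fun A => f (F A)).
Proof.
move=> polyf polyF; elim: polyf => [c|a b|{}f g _ IHf _ IHg|{}f g _ IHf _ IHg].
- exact: polyfun_cst.
- exact: polyF.
- exact: polyfunD.
- exact: polyfunM.
Qed.

Lemma polymap_mulmx d m n l (F : 'M[K]_d -> 'M[K]_(m, n)) (G : 'M[K]_d -> 'M[K]_(n, l)) :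
  polymap F -> polymap G -> polymap (fun A => F A *m G A).
Proof.
move=> polyF polyG a b; under eq_fun do rewrite mxE.
by apply: polyfun_sum => i; exact: polyfunM.
Qed.

Lemma polymap_cst d m n (M : 'M[K]_(m, n)) : polymap (fun _ : 'M[K]_d => M).
Proof. by move=> a b; exact: polyfun_cst. Qed.

Lemma polymap_id d : polymap (@id 'M[K]_d).
Proof. by move=> a b; exact: polyfun_coord. Qed.

Lemma polyfun_det d n (F : 'M[K]_d -> 'M[K]_n) :
  polymap F -> polyfun (fun A => \det (F A)).
Proof.
move=> polyF; apply: polyfun_sum => s; apply: polyfunM; first exact: polyfun_cst.
by apply: polyfun_prod => i; exact: polyF.
Qed.

Lemma polymap_adj d : polymap (fun A : 'M[K]_d => \adj A).
Proof.
move=> a b; under eq_fun do rewrite mxE.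
apply: polyfunM; first exact: polyfun_cst.
apply: polyfun_det => i j; under eq_fun do rewrite !mxE.
exact: polyfun_coord.
Qed.

Lemma polyfun_invmx d (f : 'M[K]_d -> K) : polyfun f -> exists n, exists2 g, polyfun g &
  forall A, A \in unitmx -> g A = \det A ^+ n * f (invmx A).
Proof.
have polydet n : polyfun (fun A : 'M[K]_d => \det A ^+ n).
  exact/polyfunX/polyfun_det/polymap_id.
elim=> [c|a b|{}f g _ [n [f' polyf' fE]] _ [m [g' polyg' gE]]
            |{}f g _ [n [f' polyf' fE]] _ [m [g' polyg' gE]]].
- by exists 0%N, (fun=> c) => [|A _]; [exact: polyfun_cst|rewrite expr0 mul1r].
- exists 1%N, (fun A => \adj A a b) => [|A uA]; first exact: polymap_adj.
  rewrite expr1 /invmx uA [X in _ * X]mxE mulrA divff ?mul1r//.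
  by move: uA; rewrite unitmxE unitfE.
- exists (n + m)%N, (fun A => \det A ^+ m * f' A + \det A ^+ n * g' A) => [|A uA].
    by apply: polyfunD; exact: polyfunM.
  by rewrite fE// gE// exprD; ring.
- exists (n + m)%N, (fun A => f' A * g' A) => [|A uA]; first exact: polyfunM.
  by rewrite fE// gE// exprD; ring.
Qed.

Lemma polyfun_poly_eval d (P : mpoly.mpoly (d * d) K) :
  polyfun (fun A : 'M[K]_d => poly_eval A P).
Proof.
rewrite /poly_eval; under eq_fun do rewrite mpoly.mevalE.
apply: polyfun_sum => m; apply: polyfunM; first exact: polyfun_cst.
apply: polyfun_prod => i; apply: polyfunX.
case/mxvec_indexP: i => a b; under eq_fun do rewrite mxvecE.
exact: polyfun_coord.
Qed.

Lemma poly_eval_polyfun d (f : 'M[K]_d -> K) :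
  polyfun f -> exists P, forall A, poly_eval A P = f A.
Proof.
elim=> [c|a b|{}f g _ [P Pf] _ [Q Qg]|{}f g _ [P Pf] _ [Q Qg]].
- by exists (mpoly.mpolyC _ c) => A; exact: mpoly.mevalC.
- exists (mpoly.mpolyX K (mpoly.mnm1 (mxvec_index a b))) => A.
  by rewrite /poly_eval mpoly.mevalXU mxvecE.
- by exists (P + Q) => A; rewrite -Pf -Qg; exact: mpoly.mevalD.
- by exists (P * Q) => A; rewrite poly_evalM Pf Qg.
Qed.

End polynomial_functions.

Section irreducible_and_connected_sets.
Implicit Types T U : topologicalType.

Definition irreducible_set T (A : set T) := forall E F : set T,
  closed E -> closed F -> A `<=` E `|` F -> A `<=` E \/ A `<=` F.

Lemma irreducible_set_connected T (A : set T) : irreducible_set A -> connected A.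
Proof.
move=> irrA B [x Bx] [U oU BU] [F cF BF].
have AUF : A `<=` ~` U `|` F.
  move=> y Ay; have [Uy|] := pselect (U y); last by left.
  by right; have : B y; [rewrite BU|rewrite BF => -[]].
have cU : closed (~` U) by rewrite closedC.
have [AU|AF] := irrA _ _ cU cF AUF; last by rewrite BF; exact/setIidPl.
by move: Bx; rewrite BU => -[/AU].
Qed.

Lemma connected_subset_closure T (A B : set T) :
  connected A -> A `<=` B -> B `<=` closure A -> connected B.
Proof.
move=> cA AB BA; apply/connectedP => E [E0 BE sE].
have AE : exists b, A `<=` E b.
  have /(connected_subset sE)/(_ cA)[AE|AE] : A `<=` E false `|` E true by rewrite -BE.
    by exists false.
  by exists true.
have [b {}AE] := AE; have [x Ex] := E0 (~~ b).
have Bx : B x by rewrite BE; case: b Ex {AE}; [left|right].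
have clEx := closureS AE (BA x Bx).
have [dis1 dis2] := sE; suff : set0 x by [].
by case: b {AE} Ex clEx => Ex clEx; [rewrite -dis2|rewrite -dis1].
Qed.

Lemma connected_component_relclosed T (A : set T) x :
  A `&` closure (connected_component A x) `<=` connected_component A x.
Proof.
have [Ax|nAx] := pselect (A x); last by rewrite connected_component_out// closure0 setI0.
apply: connected_component_max.
- by split=> //; exact/subset_closure/connected_component_refl.
- by move=> y [].
- apply: (connected_subset_closure (@component_connected _ A x)) => [y cy|y []//].
  by split; [exact: connected_component_sub cy|exact: subset_closure].
Qed.

Lemma dense_connected_component_cover T (A D : set T) (s : seq T) :
  A `<=` closure D ->
  (forall x, D x -> exists2 y, y \in s & connected_component A y x) ->
  forall x, A x -> exists2 y, y \in s & connected_component A y x.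
Proof.
move=> AD coverD x Ax; pose E := \big[setU/set0]_(y <- s) closure (connected_component A y).
have cE : closed E by apply: closed_bigsetU => y _; exact: closed_closure.
have DE : D `<=` E.
  move=> z /coverD[y ys cz]; rewrite /E -bigcup_seq.
  by exists y => //; exact: subset_closure.
have : E x by have := AD x Ax; rewrite closureE; exact.
rewrite /E -bigcup_seq => -[y /= ys clx]; exists y => //.
exact: connected_component_relclosed.
Qed.

Lemma card_connected_components_le T (A : set T) (s : seq T) :
  (forall x, A x -> exists2 y, y \in s & connected_component A y x) ->
  (connected_component A @` A #<= `I_(size s))%card.
Proof.
move=> cover; pose F i := connected_component A (tnth (in_tuple s) i).
rewrite (card_le_eqr card_II); apply: (card_le_trans _ (card_image_le F _)).
apply: subset_card_le => _ [x Ax <-]; have [y ys cyx] := cover x Ax.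
have /tnthP[i yE] : y \in in_tuple s by [].
by exists i => //; rewrite /F -yE; exact: same_connected_component.
Qed.

Lemma closure_sub_preimage T U (f : T -> U) (A : set T) (B : set U) :
  continuous f -> A `<=` f @^-1` B -> closure A `<=` f @^-1` closure B.
Proof.
move=> /continuous_closedP fcont AfB; rewrite [X in X `<=` _]closureE.
apply: smallest_sub; first by apply: fcont; exact: closed_closure.
by move=> x /AfB fBx; exact: subset_closure.
Qed.

End irreducible_and_connected_sets.

Section zariski_topology.
Variables (K : fieldType) (d : nat).
Implicit Types (S E : set (zariski_mx K d)) (M A : 'M[K]_d).

Lemma closed_polyfun_zeros (f : 'M[K]_d -> K) :
  polyfun f -> closed [set A : zariski_mx K d | f A = 0].
Proof.
move=> /poly_eval_polyfun[P PE]; rewrite -openC.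
exists [set P]; congr (~` _); apply/seteqP; split=> A /=.
  by move=> fA _ ->; rewrite PE.
by move=> /(_ P erefl); rewrite PE.
Qed.

Lemma zariski_closed_separation E A : closed E -> ~ E A ->
  exists2 f, polyfun f & (forall M, E M -> f M = 0) /\ f A != 0.
Proof.
rewrite -openC => -[I /(congr1 setC)]; rewrite !setCK => ->.
move=> /existsNP[P /not_implyP[IP PA]].
exists (fun A => poly_eval A P); first exact: polyfun_poly_eval.
by split; [move=> M /(_ P IP)|exact/eqP].
Qed.

Lemma zariski_closureP S A : closure S A <->
  forall f, polyfun f -> (forall M, S M -> f M = 0) -> f A = 0.
Proof.
split=> [clA f polyf fS|vanish].
  have := clA; rewrite closureE => /(_ [set A : zariski_mx K d | f A = 0]); apply.
  by split=> //; exact: closed_polyfun_zeros.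
apply: contrapT => /(zariski_closed_separation (@closed_closure _ S))[f polyf [fS /eqP]].
by apply; apply: vanish => // M SM; apply: fS; exact: subset_closure.
Qed.

Lemma polymap_continuous (F : 'M[K]_d -> 'M[K]_d) :
  polymap F -> continuous (F : zariski_mx K d -> zariski_mx K d).
Proof.
move=> polyF; apply/continuous_closedP => E cE; apply/closure_id.
apply/seteqP; split; first exact: subset_closure.
move=> A /zariski_closureP clA; apply: contrapT.
move=> /(zariski_closed_separation cE)[f polyf [fE /eqP]]; apply.
by apply: (clA _ (polyfun_comp polyf polyF)) => M; exact: fE.
Qed.

Lemma mulmxl_zariski_continuous M :
  continuous (fun A : zariski_mx K d => M *m A : zariski_mx K d).
Proof. exact/polymap_continuous/polymap_mulmx/polymap_id/polymap_cst. Qed.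

Lemma connected_mulmxl M S : connected S ->
  connected ([set M *m A | A in S] : set (zariski_mx K d)).
Proof.
move=> connS; apply: connected_continuous_connected => //.
exact/continuous_subspaceT/mulmxl_zariski_continuous.
Qed.

Lemma mulmxr_zariski_continuous M :
  continuous (fun A : zariski_mx K d => A *m M : zariski_mx K d).
Proof. exact/polymap_continuous/(polymap_mulmx (@polymap_id _ _))/polymap_cst. Qed.

Lemma zariski_closure_invmx S A : S `<=` @GL K d -> A \in unitmx ->
  closure S A -> closure (invmx @` S : set (zariski_mx K d)) (invmx A).
Proof.
move=> Sunit uA /zariski_closureP clA; apply/zariski_closureP => f polyf fS.
have [n [g polyg gE]] := polyfun_invmx polyf.
have : g A = 0.
  apply: clA => // M SM; rewrite gE; last exact: Sunit.
  by rewrite fS ?mulr0//; exists M.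
rewrite gE// => /eqP; rewrite mulf_eq0 expf_eq0.
by move: uA; rewrite unitmxE unitfE => /negbTE ->; rewrite andbF => /eqP.
Qed.

Lemma irreducible_set_polyfun S :
  (forall f g, polyfun f -> polyfun g -> (forall A, S A -> f A * g A = 0) ->
    (forall A, S A -> f A = 0) \/ (forall A, S A -> g A = 0)) ->
  irreducible_set S.
Proof.
move=> domain E F cE cF SEF; apply: contrapT => /not_orP[].
move=> /existsNP[A /not_implyP[SA EA]] /existsNP[B /not_implyP[SB FB]].
have [f polyf [fE /eqP fA]] := zariski_closed_separation cE EA.
have [g polyg [gF /eqP gB]] := zariski_closed_separation cF FB.
have [M SM|f0|g0] := domain f g polyf polyg; last 2 first.
- exact/fA/f0.
- exact/gB/g0.
by have [/fE ->|/gF ->] := SEF M SM; rewrite ?mul0r ?mulr0.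
Qed.

End zariski_topology.

Section matrix_groups.
Variables (K : fieldType) (d : nat).
Implicit Types (S G : set 'M[K]_d) (x y : 'M[K]_d).
Local Notation component G := (connected_component (G : set (zariski_mx K d))).

Definition matrix_group G :=
  [/\ G `<=` @GL K d, G 1%:M, forall x y, G x -> G y -> G (x *m y) &
      forall x, G x -> G (invmx x)].

Lemma subset_zariski_closure_GL S : matrix_group S -> S `<=` zariski_closure_GL S.
Proof.
by case=> Sunit _ _ _ x Sx; split; [exact: Sunit|exact: (@subset_closure (zariski_mx K d))].
Qed.

Lemma zariski_closure_GL_group S :
  matrix_group S -> matrix_group (zariski_closure_GL S).
Proof.
move=> groupS; have [Sunit S1 SM SV] := groupS.
have mulSl x y : S x -> closure (S : set (zariski_mx K d)) y ->
    closure (S : set (zariski_mx K d)) (x *m y).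
  move=> Sx; apply: (closure_sub_preimage (@mulmxl_zariski_continuous _ _ x)).
  by move=> z; exact: SM.
split.
- by move=> x [].
- exact: subset_zariski_closure_GL.
- move=> x y [ux clx] [uy cly]; split; first by rewrite /GL /= unitmx_mul ux.
  rewrite [closure _](closure_id _).1; last exact: closed_closure.
  apply: (closure_sub_preimage (@mulmxr_zariski_continuous _ _ y)) clx => z Sz.
  exact: mulSl.
- move=> x [ux clx]; split; first by rewrite /GL /= unitmx_inv.
  apply: closureS (zariski_closure_invmx Sunit ux clx) => _ [y Sy <-].
  exact: SV.
Qed.

Lemma mulmxl_connected_component_sub G x y : matrix_group G -> G x -> G y ->
  [set x *m z | z in component G y] `<=` component G (x *m y).
Proof.
move=> [_ _ GM _] Gx Gy; apply: (@connected_component_max (zariski_mx K d)).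
- by exists y => //; exact: (@connected_component_refl (zariski_mx K d)).
- by move=> _ [z /connected_component_sub Gz <-]; exact: GM.
- exact/connected_mulmxl/component_connected.
Qed.

Lemma pi0E G : matrix_group G -> pi0 G = component G @` G.
Proof.
move=> groupG; have [Gunit G1 GM GV] := groupG; apply: eq_imagel => g Gg.
have ug := Gunit g Gg; apply/seteqP; split=> [x cx|x cx].
  by rewrite -[g]mulmx1; exact: mulmxl_connected_component_sub cx.
exists (invmx g *m x); last by rewrite mulmxA mulmxV// mul1mx.
rewrite /identity_component -(mulVmx ug).
by apply: mulmxl_connected_component_sub => //; [exact: GV|exists x].
Qed.

Lemma card_pi0_zariski_closure_le S (s : seq 'M[K]_d) : matrix_group S ->
  (forall x, S x -> exists2 y, y \in s & component (zariski_closure_GL S) y x) ->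
  (pi0 (zariski_closure_GL S) #<= `I_(size s))%card.
Proof.
move=> groupS cover; rewrite (pi0E (zariski_closure_GL_group groupS)).
apply: (@card_connected_components_le (zariski_mx K d)).
by apply: (@dense_connected_component_cover (zariski_mx K d) _ S) => // x [].
Qed.

End matrix_groups.

Section matrix_powers.
Variables (R : realType) (K : valuedFieldType R) (d : nat).
Implicit Types (theta : R) (A : 'M[K]_d).

Lemma polyfun_exp_diff_bounded theta C A f : 0 <= theta ->
  (forall a b, diff_bounded theta C (fun k => (A ^+ k) a b)) ->
  polyfun f -> exists C', diff_bounded theta C' (fun k => f (A ^+ k)).
Proof.
move=> theta0 coefA; elim=> [c|a b|{}f g _ [C1 fC] _ [C2 gC]|{}f g _ [C1 fC] _ [C2 gC]].
- by exists (absv c); exact: diff_bounded_cst.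
- by exists C.
- exists (Num.max C1 C2); apply: diff_boundedD.
    by apply: diff_bounded_le fC; rewrite ?le_max ?lexx.
  by apply: diff_bounded_le gC; rewrite ?le_max ?lexx ?orbT.
- by exists (C1 * C2); exact: diff_boundedM.
Qed.

Variables sigma rho : R.
Hypotheses (sigma_gt0 : 0 < sigma) (rho_gt0 : 0 < rho) (rho_lt1 : rho < 1).
Hypothesis sigma_fact : fact_absv_ge K sigma.

Lemma powers_irreducible A :
  near_unipotent (trace_tolerance K d (sigma * rho)) A ->
  irreducible_set (range (fun k => A ^+ k) : set (zariski_mx K d)).
Proof.
move=> trA; have theta_gt0 : 0 < sigma * rho by rewrite mulr_gt0.
have sigma_le1 : sigma <= 1 by have := sigma_fact 1; rewrite expr1 absv1.
have theta_le1 : sigma * rho <= 1 by rewrite mulr_ile1// ltW.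
have fact0 := natr_fact_neq0 d (fact_absv_ge_pchar0 sigma_gt0 sigma_fact).
have [C coefA] := exp_coef_diff_bounded fact0 theta_gt0 theta_le1 trA.
have zeros f : polyfun f -> infinite_set [set k | f (A ^+ k) = 0] ->
    forall M, range (fun k => A ^+ k) M -> f M = 0.
  move=> /(polyfun_exp_diff_bounded (ltW theta_gt0) coefA)[C' fC] inf _ [k _ <-].
  exact: (infinite_zeros_eq0 sigma_gt0 (ltW rho_gt0) rho_lt1 sigma_fact fC).
apply: irreducible_set_polyfun => f g polyf polyg fg0.
have [finf|] := pselect (finite_set [set k | f (A ^+ k) = 0]); last by left; exact: zeros.
right; apply: zeros => // fing; apply: infinite_nat.
apply: (@sub_finite_set _ _ ([set k | f (A ^+ k) = 0] `|` [set k | g (A ^+ k) = 0])).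
  move=> k _; have /eqP : f (A ^+ k) * g (A ^+ k) = 0 by apply: fg0; exists k.
  by rewrite mulf_eq0 => /orP[/eqP|/eqP]; [left|right].
by rewrite finite_setU.
Qed.

End matrix_powers.

Section almost_periodicity.
Variable R : realType.

Lemma compact_nbhs_finite_cover (T : topologicalType) (V : T -> set T) :
  compact [set: T] -> (forall x, nbhs x (V x)) ->
  exists s : seq T, forall y, exists2 x, x \in s & V x y.
Proof.
move=> /compact_near_coveringP T_cover nbhsV.
pose F : set_system (seq T) :=
  filter_from [set: seq T] (fun s0 => [set s : seq T | {subset s0 <= s}]).
have filterF : Filter F.
  apply: filter_from_filter; first by exists [::].
  move=> s1 s2 _ _; exists (s1 ++ s2) => // s s12s.
  by split=> x xs; apply: s12s; rewrite mem_cat xs ?orbT.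
have [x _|s _ /(_ s (fun _ => id)) cover] :=
    T_cover _ F (fun s y => exists2 x, x \in s & V x y) filterF; last first.
  by exists s => y; exact: cover.
exists (V x, [set s : seq T | x \in s]) => /=.
  split=> //; exists [:: x] => // s; apply; exact: mem_head.
by move=> [y s] [/= Vxy xs]; exists x.
Qed.

Lemma compact_near_uniform (T U : topologicalType) (M : pseudoMetricType R)
    (F : T * U -> M) (x : T) (e : R) :
  compact [set: U] -> continuous F -> 0 < e ->
  \forall x' \near x, forall u, ball (F (x, u)) e (F (x', u)).
Proof.
move=> /compact_near_coveringP U_cover Fcont e0.
have e2 : 0 < e / 2 by rewrite divr_gt0.
have near_u u : [set: U] u ->
    \forall u' \near u & x' \near x, ball (F (x, u')) e (F (x', u')).
  move=> _; have /cvg_ballP/(_ _ e2) : F xu @[xu --> (x, u)] --> F (x, u) by exact: Fcont.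
  move=> [[X W] [/= Xx Wu] XW]; exists (W, X) => // -[u' x'] [/= Wu' Xx'].
  have Bx := XW (x, u') (conj (nbhs_singleton Xx) Wu').
  exact: ball_splitr Bx (XW (x', u') (conj Xx' Wu')).
by apply: filterS (U_cover _ _ _ _ near_u) => x' cover u; exact: cover u I.
Qed.

Lemma cvg_uniform_cauchy_tail (T : choiceType) (K : valuedFieldType R)
    (f : nat -> T -> K) (l : T -> K) (e : R) :
  {uniform, f @ \oo --> l} -> 0 < e ->
  exists N, forall n g, (N <= n)%N -> absv (f n g - f N g) <= e.
Proof.
move=> f_cvg e0; have [|N _ near_l] := f_cvg [set h | forall g, absv (l g - h g) <= e].
  apply/uniform_nbhs; exists [set xy | ball xy.1 e xy.2]; split.
    exact: (entourage_ball _ (PosNum e0)).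
  move=> h lh g /=; have : ball (l g) e (h g) by exact: lh.
  by rewrite ball_absvE => /ltW.
exists N => n g Nn; have -> : f n g - f N g = (l g - f N g) - (l g - f n g) by ring.
by apply: absvB_le; [exact: (near_l N (leqnn N) g)|exact: (near_l n Nn g)].
Qed.

Variables (K : valuedFieldType R) (Gamma : topGroupType).
Hypothesis Gamma_compact : compact [set: Gamma].
Implicit Types (f : Gamma -> K) (e : R) (s : seq Gamma).

Definition translate_net e f s := forall g, exists2 g', g' \in s &
  forall h, absv (f (g * h)%g - f (g' * h)%g) <= e.

Lemma translate_net_exists e f : continuous f -> 0 < e -> exists s, translate_net e f s.
Proof.
move=> fcont e0; pose V g := [set g' | forall h, ball (f (g * h)%g) e (f (g' * h)%g)].
have [g|s cover] := @compact_nbhs_finite_cover _ V Gamma_compact.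
  apply: (compact_near_uniform (F := fun gh => f (gh.1 * gh.2)%g)) => // gh.
  by apply: continuous_comp; [exact: mulg_continuous|exact: fcont].
exists s => g; have [g' g's g'g] := cover g; exists g' => // h.
by have := g'g h; rewrite ball_absvE -absvN opprB => /ltW.
Qed.

Lemma translate_net_close e f f' s : (forall g, absv (f' g - f g) <= e) ->
  translate_net e f s -> translate_net e f' s.
Proof.
move=> ff' net g; have [g' g's gg'] := net g; exists g' => // h.
have -> : f' (g * h)%g - f' (g' * h)%g = (f' (g * h)%g - f (g * h)%g) +
    (f (g * h)%g - f (g' * h)%g) - (f' (g' * h)%g - f (g' * h)%g) by ring.
by rewrite absvB_le// absvD_le.
Qed.

Lemma translate_net_uniform (f : nat -> Gamma -> K) (l : Gamma -> K) e :
  (forall n, continuous (f n)) -> {uniform, f @ \oo --> l} -> 0 < e ->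
  exists N, forall n, exists2 s, (size s <= N)%N & translate_net e (f n) s.
Proof.
move=> fcont f_cvg e0; have [N tail] := cvg_uniform_cauchy_tail f_cvg e0.
have /choice[s net] n := translate_net_exists (fcont n) e0.
exists (\max_(n < N.+1) size (s n)) => n; pose m := minn n N.
exists (s m).
  have mN : (m < N.+1)%N by rewrite ltnS geq_minr.
  exact: (leq_bigmax (F := fun n : 'I_N.+1 => size (s n)) (Ordinal mN)).
apply: translate_net_close (net m) => g; rewrite /m.
by case: leqP => [_|/ltnW/tail//]; rewrite subrr absv0 ltW.
Qed.

End almost_periodicity.

Lemma continuous_mxtrace (R : realType) (K : valuedFieldType R) (d : nat)
    (T : topologicalType) (r : T -> 'M[K]_d) :
  continuous r -> continuous (fun x => \tr (r x)).
Proof.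
move=> r_cont x; apply/cvg_ballP => e e0; have e2 : 0 < e / 2 by rewrite divr_gt0.
have /cvg_ballP/(_ _ e2) : r y @[y --> x] --> r x by exact: r_cont.
apply: filterS => y r_xy; rewrite ball_absvE.
apply: (@le_lt_trans _ _ (e / 2)); last by rewrite ltr_pdivrMr// ltr_pMr// ltr1n.
rewrite -raddfB; apply: absv_sum_le => [|i _]; first exact: ltW.
by case: r_xy => _ /(_ i i); rewrite ball_absvE !mxE => /ltW.
Qed.

Section representations.
Variables (R : realType) (K : valuedFieldType R) (d : nat) (Gamma : topGroupType).
Variable r : Gamma -> 'M[K]_d.
Hypothesis r_rep : continuous_representation r.

Lemma representation_unitmx g : r g \in unitmx.
Proof.
have [r1 rM _] := r_rep; have rVg : r g^-1%g *m r g = 1%:M by rewrite -rM mulVg r1.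
by have [] := mulmx1_unit rVg.
Qed.

Lemma representation_invmx g : invmx (r g) = r g^-1%g.
Proof.
have [r1 rM _] := r_rep.
rewrite -[RHS]mulmx1 -(mulmxV (representation_unitmx g)) mulmxA -rM.
by rewrite mulVg r1 mul1mx.
Qed.

Lemma representation_exp g k : r (g ^+ k)%g = r g ^+ k.
Proof.
have [r1 rM _] := r_rep.
by elim: k => [|k IH]; rewrite ?expg0 ?r1// expgS rM IH exprS.
Qed.

Lemma range_matrix_group : matrix_group (range r).
Proof.
have [r1 rM _] := r_rep; split.
- by move=> _ [g _ <-]; exact: representation_unitmx.
- by exists 1%g.
- by move=> _ _ [g _ <-] [h _ <-]; exists (g * h)%g.
- by move=> _ [g _ <-]; exists g^-1%g => //; rewrite representation_invmx.
Qed.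

Variables sigma rho : R.
Hypotheses (sigma_gt0 : 0 < sigma) (rho_gt0 : 0 < rho) (rho_lt1 : rho < 1).
Hypothesis sigma_fact : fact_absv_ge K sigma.
Let eps := trace_tolerance K d (sigma * rho).

(* [r g'] times the powers of [r (g'^-1 g)] is a connected set joining [r g'] to
   [r g]. *)
Lemma trace_close_connected_component g g' :
  (forall h, absv (\tr (r (g * h)%g) - \tr (r (g' * h)%g)) <= eps) ->
  connected_component (zariski_closure_GL (range r) : set (zariski_mx K d)) (r g') (r g).
Proof.
have [_ rM _] := r_rep; pose x := (g'^-1 * g)%g => gg'.
have trx : near_unipotent eps (r x).
  move=> k; rewrite -!representation_exp; have := gg' (x ^+ k * g'^-1)%g.
  rewrite !mulgA !rM ![\tr (_ *m r (g'^-1)%g)]mxtrace_mulC.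
  by rewrite -!rM !mulgA mulVg mul1g -/x -expgS.
have irr := powers_irreducible sigma_gt0 rho_gt0 rho_lt1 sigma_fact trx.
apply: (@connected_component_max (zariski_mx K d) _
  [set r g' *m A | A in range (fun k => r x ^+ k)]).
- by exists 1%:M; [exists 0%N|rewrite mulmx1].
- move=> _ [_ [k _ <-] <-]; apply: (subset_zariski_closure_GL range_matrix_group).
  by exists (g' * x ^+ k)%g; rewrite // rM representation_exp.
- exact/connected_mulmxl/irreducible_set_connected/irr.
- exists (r x); first by exists 1%N.
  by rewrite -rM /x mulgA mulgV mul1g.
Qed.

Lemma card_pi0_le_translate_net s :
  translate_net eps (fun g => \tr (r g)) s ->
  (pi0 (zariski_closure_GL (range r)) #<= `I_(size s))%card.
Proof.
move=> net; rewrite -(size_map r).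
apply: (card_pi0_zariski_closure_le range_matrix_group) => _ [g _ <-].
have [g' g's gg'] := net g; exists (r g'); first exact: map_f.
exact: trace_close_connected_component.
Qed.

End representations.

Lemma logn_fact_le p n : prime p -> (logn p n`! <= n)%N.
Proof.
move=> p_pr; rewrite logn_fact//.
suff sum_le m : (\sum_(1 <= k < m.+1) n %/ p ^ k + n %/ p ^ m <= n)%N.
  by apply: leq_trans (sum_le n); rewrite leq_addr.
elim: m => [|m IH]; first by rewrite big_geq// expn0 divn1.
apply: leq_trans IH; rewrite big_nat_recr//= -addnA leq_add2l addnn -muln2.
by rewrite expnSr divnMA (leq_trans _ (leq_divM _ p))// leq_mul2l prime_gt1// orbT.
Qed.

Section padic_absolute_value.
Variables (R : realType) (p : nat) (C : valuedFieldType R).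
Hypotheses (p_prime : prime p) (C_is_Cp : is_Cp p C).

Lemma Cp_absv_natr n : (0 < n)%N -> absv (n%:R : C) = (p%:R^-1 : R) ^+ logn p n.
Proof.
case: C_is_Cp => [Qp [Qpbar [h [i [j [[hE _ _] _ iE [jE _ _]]]]]]] n0.
rewrite -(rmorph_nat j) jE -(rmorph_nat i) iE -(rmorph_nat h) hE /padic_abs.
rewrite pnatr_eq0 gtn_eqF// -[n%:R]/(n%:Z%:~R) numq_int denq_int !absz_nat logn1.
by rewrite sub0r -exprnN exprVn.
Qed.

Lemma Cp_fact_absv_ge : fact_absv_ge C (p%:R^-1 : R).
Proof.
move=> j; rewrite Cp_absv_natr ?fact_gt0// ler_wiXn2l ?logn_fact_le ?invr_ge0//.
by rewrite invf_le1 ?ler1n ?ltr0n prime_gt0.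
Qed.

End padic_absolute_value.

Theorem theorem2p4 (R : realType) (p : nat) (p_prime : prime p)
    (Cp : valuedFieldType R) (Cp_is_Cp : is_Cp p Cp)
    (Gamma : topGroupType) (Gamma_compact : compact [set: Gamma])
    (d : nat) (rho : nat -> Gamma -> 'M[Cp]_d)
    (rho_rep : forall n, continuous_representation (rho n))
    (rho_cvg : uniformly_trace_convergent rho) :
  exists N : nat, forall n,
    (pi0 (zariski_closure_GL (range (rho n))) #<= `I_N)%card.
Proof.
have pinv_gt0 : 0 < (p%:R^-1 : R) by rewrite invr_gt0 ltr0n prime_gt0.
have pinv_lt1 : (p%:R^-1 : R) < 1.
  by rewrite invf_lt1 ?ltr1n ?ltr0n ?prime_gt0 ?prime_gt1.
have fact_ge := Cp_fact_absv_ge p_prime Cp_is_Cp.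
pose eps := trace_tolerance Cp d (p%:R^-1 * p%:R^-1 : R).
have eps_gt0 : 0 < eps.
  by rewrite mulr_gt0 ?exprn_gt0 ?mulr_gt0// (lt_le_trans _ (fact_ge d)) ?exprn_gt0.
have trace_cont n : continuous (fun g => \tr (rho n g)).
  by have [_ _ /continuous_mxtrace] := rho_rep n.
have [f f_cvg] := rho_cvg.
have [N nets] := translate_net_uniform Gamma_compact trace_cont f_cvg eps_gt0.
exists N => n; have [s sN net] := nets n.
have sN_card : (`I_(size s) #<= `I_N)%card by rewrite card_le_II.
apply: card_le_trans sN_card.
exact: (card_pi0_le_translate_net (rho_rep n) pinv_gt0 pinv_gt0 pinv_lt1 fact_ge net).
Qed.
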